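(* Consider the inexact Rayleigh quotient iteration for a Hermitian matrix $A$ described in the context, with an arbitrary solver for the inner linear systems. Suppose that the uniform positiveness condition $$|\cos\phi_k+\xi_k\cos\psi_k|\ge c$$ is satisfied with a constant $c>0$ uniformly independent of $k$. Then $$\|r_{k+1}\|\le\frac{8\beta^2\xi_k}{c\,|\lambda_2-\lambda|}\|r_k\|^2+O(\|r_k\|^3).$$
   Context: Setting. $A\in\mathbb{C}^{n\times n}$ is Hermitian with eigenvalues $\lambda=\lambda_1,\lambda_2,\ldots,\lambda_n$ and corresponding orthonormal eigenvectors $x=x_1,x_2,\ldots,x_n$; $(\lambda,x)$ is the desired eigenpair. $\lambda_{\min},\lambda_{\max}$ are the smallest and largest eigenvalues of $A$, $\|\cdot\|$ is the Euclidean norm, and $$\beta=\frac{\lambda_{\max}-\lambda_{\min}}{|\lambda_2-\lambda|}.$$ Inexact Rayleigh quotient iteration (RQI): given a unit vector $u_k$, put $\theta_k=u_k^*Au_k$; compute an approximate solution $w_{k+1}$ of $(A-\theta_kI)w=u_k$, so that $$(A-\theta_kI)w_{k+1}=u_k+\xi_kd_k,\qquad \|d_k\|=1,$$ where $\xi_k\ge 0$ is the (relative) residual norm, uniformly bounded in $k$, and $d_k$ the residual direction; then set $u_{k+1}=w_{k+1}/\|w_{k+1}\|$. The outer residual is $r_k=(A-\theta_kI)u_k$. Standing assumption: $u_k$ is a reasonably good approximation to $x$ in the sense that, for every $k$ considered, $|\lambda-\theta_k|<|\lambda_2-\theta_k|\le\cdots\le|\lambda_n-\theta_k|$ and $|\lambda-\theta_k|<\tfrac12|\lambda-\lambda_2|$.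 Angles: $\phi_k=\angle(u_k,x)$ is the acute angle between $u_k$ and $x$, and $\psi_k=\angle(d_k,x)\in[0,\pi]$; one writes the orthogonal decompositions $u_k=x\cos\phi_k+e_k\sin\phi_k$ with $e_k\perp x$, $\|e_k\|=1$, and $d_k=x\cos\psi_k+f_k\sin\psi_k$ with $f_k\perp x$, $\|f_k\|=1$ (the coefficients along $x$ being taken real). $O(\cdot)$ is as $\|r_k\|\to0$, with constant independent of $k$. *)

(* Defs.v *)
(* Written over MathComp-Analysis; the complex numbers are R[i], R : realType. *)
From mathcomp Require Import all_boot all_order all_algebra.
From mathcomp Require Import complex.
From mathcomp Require Import all_classical all_reals all_analysis.

Set Implicit Arguments.
Unset Strict Implicit.
Unset Printing Implicit Defensive.

Import Order.TTheory GRing.Theory Num.Theory.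
Import numFieldNormedType.Exports.

Local Open Scope ring_scope.
Local Open Scope sesquilinear_scope.
Local Open Scope complex_scope.

Section Euclidean.
Variables (R : realType) (m : nat).
Implicit Types u v y : 'cV[R[i]]_m.

Definition dotv u v : R[i] := (u ^t* *m v) 0 0.

(* The norm that the library puts on matrices is the max norm. *)
Definition enorm v : R := Num.sqrt (\sum_i Normc.normc (v i 0) ^+ 2).

(* In [0, pi/2]: the angle between the lines spanned by u and v. *)
Definition acute_angle u v : R :=
  acos (Normc.normc (dotv u v) / (enorm u * enorm v)).

(* In [0, pi]: the angle between the vectors u and v. *)
Definition vec_angle u v : R :=
  acos (complex.Re (dotv u v) / (enorm u * enorm v)).

(* For unit v and y this forces the coefficient of v along y to be real. *)
Definition decomposes_along y (t : R) v : Prop :=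
  exists f, [/\ dotv y f = 0, enorm f = 1
    & v = (cos t)%:C *: y + (sin t)%:C *: f].

Definition orthonormal_basis (x : 'I_m -> 'cV[R[i]]_m) : Prop :=
  forall i j, dotv (x i) (x j) = (i == j)%:R.

End Euclidean.

Section RayleighQuotientIteration.
Variables (R : realType) (m : nat) (A : 'M[R[i]]_m).

(* For Hermitian A the number u^* A u is real. *)
Definition rayleigh (u : 'cV[R[i]]_m) : R := complex.Re (dotv u (A *m u)).

Definition shifted (u : 'cV[R[i]]_m) : 'M[R[i]]_m := A - (rayleigh u)%:C%:M.

Definition residual (u : 'cV[R[i]]_m) : 'cV[R[i]]_m := shifted u *m u.

(* No inner solver is fixed: xi k and d k are whatever residual norm and
   direction the approximate solution w k.+1 happens to have; w 0 is unused. *)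
Record inexact_rqi (u w d : nat -> 'cV[R[i]]_m) (xi : nat -> R) : Prop :=
  InexactRqi {
    rqi_unit0 : enorm (u 0%N) = 1;
    rqi_solve : forall k,
      shifted (u k) *m w k.+1 = u k + (xi k)%:C *: d k;
    rqi_dir : forall k, enorm (d k) = 1;
    rqi_xi_ge0 : forall k, 0 <= xi k;
    rqi_next : forall k, u k.+1 = ((enorm (w k.+1))^-1)%:C *: w k.+1
  }.

End RayleighQuotientIteration.

Section Spectrum.
Variables (R : realType) (n : nat) (lambda : 'I_n.+2 -> R).

(* lambda 0 is the desired eigenvalue, lambda 1 the second one. *)

Definition lambda_min : R := \big[Num.min/lambda 0]_i lambda i.
Definition lambda_max : R := \big[Num.max/lambda 0]_i lambda i.

Definition beta : R :=
  (lambda_max - lambda_min) / `|lambda 1 - lambda 0|.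

Definition good_shift (theta : R) : Prop :=
  [/\ `|lambda 0 - theta| < `|lambda 1 - theta|,
      forall i j : 'I_n.+2, (1 <= i <= j)%N ->
        `|lambda i - theta| <= `|lambda j - theta|
    & `|lambda 0 - theta| < 2^-1 * `|lambda 0 - lambda 1|].

End Spectrum.

(* An eigenvector is only determined up to a phase, and so are the iterates
   relative to it (e.g. the coefficient of u k along x changes sign at every
   step if lambda is the smallest eigenvalue and xi = 0).  For the coefficient
   of u k along x to be cos (phi k) >= 0, x must be multiplied by a unimodular
   factor omega k depending on k; the same multiple serves as the reference
   direction for d k. *)
Definition rqi_angles (R : realType) (m : nat) (x : 'cV[R[i]]_m)
    (u d : nat -> 'cV[R[i]]_m) (omega : nat -> R[i]) (phi psi : nat -> R)
    : Prop :=
  forall k,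
    [/\ Normc.normc (omega k) = 1,
        phi k = acute_angle (u k) x,
        psi k = vec_angle (d k) (omega k *: x),
        decomposes_along (omega k *: x) (phi k) (u k)
      & decomposes_along (omega k *: x) (psi k) (d k)].

(* Main.v *)
Require Import Defs.
From mathcomp Require Import all_boot all_order all_algebra.
From mathcomp Require Import complex.
From mathcomp Require Import all_classical all_reals all_analysis.
From mathcomp Require Import ring lra.

Set Implicit Arguments.
Unset Strict Implicit.
Unset Printing Implicit Defensive.

Import Order.TTheory GRing.Theory Num.Theory.
Import numFieldNormedType.Exports.

Local Open Scope ring_scope.
Local Open Scope complex_scope.

(** The whole argument takes place in coordinates on the eigenbasis, where the
shifted matrix acts on the i-th coordinate as multiplication by
lambda i - theta.  A vector is split into its head, the coordinate on x 0, and
its tail, the projection on the span of the other eigenvectors; for a unit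
vector the tail has norm sin phi.  Write s for the spread
lambda_max - lambda_min, delta for |lambda 1 - lambda 0| and h for delta / 2;
every shift that is a good approximation of lambda 0 stays at distance at
least h from the other eigenvalues.

Solving the shifted system divides the tail of u + xi d by at least h
([tail_norm_shift_ge]), whereas it divides the head exactly by
|lambda 0 - theta|; uniform positiveness says that this head is at least c
before the division.  So the tangent of the new angle is at most

  |lambda 0 - theta| (sin phi + xi) / (c h).

Three comparisons turn this into a bound on residuals:
 - |lambda 0 - theta| <= s sin^2 phi, because the Rayleigh quotient is a
   weighted mean of the eigenvalues ([rayleigh_error]);
 - h sin phi <= ||r||, again by [tail_norm_shift_ge];
 - the new residual has norm at most s times the sine of the new angle,
   because the Rayleigh quotient is the shift that minimizes the residual, and
   the shift lambda 0 kills the head ([residual_le_shift],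
   [enorm_shift_eigen_le]).

Together ([rqi_step_bound]) they give
||r'|| <= s^2 (||r|| / h)^2 (xi + ||r|| / h) / (h c).  With h = delta / 2 and
s = beta delta the term in xi is the announced quadratic one, and the other
one is exactly 16 beta^2 / (c delta^2) ||r||^3, so that the remainder is a
cubic monomial, valid whatever the size of r. *)

(** * The Hermitian inner product and the Euclidean norm *)

Section InnerProduct.
Variables (R : realType) (m : nat).
Implicit Types (u v : 'cV[R[i]]_m) (a : R[i]).
Local Notation normc := Normc.normc.

Lemma normc_ge0 a : 0 <= normc a.
Proof. by case: a => a b; exact: sqrtr_ge0. Qed.

Lemma normc_real (r : R) : normc r%:C = `|r|.
Proof. by rewrite /= expr0n /= addr0 sqrtr_sqr. Qed.

Lemma conjC_mul_normc a : Num.conj a * a = (normc a ^+ 2)%:C.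
Proof.
rewrite mulrC -normCK normc_def rmorphXn /=.
by case: a.
Qed.

Lemma dotvE u v : dotv u v = \sum_i Num.conj (u i 0) * v i 0.
Proof. by rewrite /dotv mxE; apply: eq_bigr => i _; rewrite !mxE. Qed.

Lemma dotvDr u v1 v2 : dotv u (v1 + v2) = dotv u v1 + dotv u v2.
Proof. by rewrite /dotv mulmxDr mxE. Qed.

Lemma dotvZr u a v : dotv u (a *: v) = a * dotv u v.
Proof. by rewrite /dotv -scalemxAr mxE. Qed.

Lemma dotvZl a u v : dotv (a *: u) v = Num.conj a * dotv u v.
Proof.
rewrite !dotvE mulr_sumr; apply: eq_bigr => i _.
by rewrite mxE rmorphM mulrA.
Qed.

Lemma dotv_sumr (I : finType) u (F : I -> 'cV[R[i]]_m) :
  dotv u (\sum_i F i) = \sum_i dotv u (F i).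
Proof. by rewrite /dotv mulmx_sumr summxE. Qed.

Lemma dotv_conj u v : dotv v u = Num.conj (dotv u v).
Proof.
rewrite !dotvE rmorph_sum; apply: eq_bigr => i _.
by rewrite rmorphM /= conjCK mulrC.
Qed.

Lemma enorm_ge0 v : 0 <= enorm v.
Proof. exact: sqrtr_ge0. Qed.

Lemma enorm_sqr v : enorm v ^+ 2 = \sum_i normc (v i 0) ^+ 2.
Proof. by rewrite sqr_sqrtr // sumr_ge0 // => i _; rewrite exprn_ge0 ?normc_ge0. Qed.

Lemma dotvv v : dotv v v = (enorm v ^+ 2)%:C.
Proof.
rewrite dotvE enorm_sqr rmorph_sum; apply: eq_bigr => i _.
exact: conjC_mul_normc.
Qed.

Lemma enormZ (r : R) v : 0 <= r -> enorm (r%:C *: v) = r * enorm v.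
Proof.
move=> r0; apply/eqP; rewrite -(@eqrXn2 _ 2) ?mulr_ge0 ?enorm_ge0 //.
rewrite exprMn !enorm_sqr mulr_sumr; apply/eqP/eq_bigr => i _.
by rewrite mxE Normc.normcM exprMn normc_real ger0_norm.
Qed.

End InnerProduct.

(** Minkowski's inequality for the l2 norm of finite real families.  The constant
8 of the theorem is only reached if the norms of the tails of u and xi d are
added with no loss, hence the sharp triangle inequality. *)
Lemma minkowski2 (R : rcfType) (I : finType) (P : pred I) (a b : I -> R) :
  (forall i, 0 <= a i) -> (forall i, 0 <= b i) ->
  Num.sqrt (\sum_(i | P i) (a i + b i) ^+ 2) <=
    Num.sqrt (\sum_(i | P i) a i ^+ 2) + Num.sqrt (\sum_(i | P i) b i ^+ 2).
Proof.
move=> a0 b0.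
have sum_ge0 (f : I -> R) : 0 <= \sum_(i | P i) f i ^+ 2.
  by apply: sumr_ge0 => i _; exact: sqr_ge0.
have sum0 (f g : I -> R) : ~~ (0 < Num.sqrt (\sum_(i | P i) f i ^+ 2)) ->
    \sum_(i | P i) (f i + g i) ^+ 2 = \sum_(i | P i) g i ^+ 2.
  rewrite sqrtr_gt0 lt_def sum_ge0 andbT negbK => /eqP f0.
  apply: eq_bigr => i Pi; suff -> : f i = 0 by rewrite add0r.
  apply/eqP; rewrite -sqrf_eq0; apply/eqP.
  by move: i Pi; apply: psumr_eq0P => // i _; exact: sqr_ge0.
set X := Num.sqrt (\sum_(i | P i) a i ^+ 2).
set Y := Num.sqrt (\sum_(i | P i) b i ^+ 2).
have [X0|X0] := boolP (0 < X); last first.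
  by rewrite (sum0 a b X0) ler_wpDl // sqrtr_ge0.
have [Y0|Y0] := boolP (0 < Y); last first.
  under eq_bigr do rewrite addrC.
  by rewrite (sum0 b a Y0) ler_wpDr // sqrtr_ge0.
rewrite -[leRHS]ger0_norm ?addr_ge0 ?sqrtr_ge0 // -sqrtr_sqr ler_sqrt ?sqr_ge0 //.
(* 2 a b <= (Y / X) a^2 + (X / Y) b^2 termwise; with these weights the right-hand
   side sums to exactly 2 X Y. *)
have -> : (X + Y) ^+ 2 = (1 + Y / X) * X ^+ 2 + (1 + X / Y) * Y ^+ 2.
  by field; rewrite !gt_eqF.
rewrite [X ^+ 2]sqr_sqrtr // [Y ^+ 2]sqr_sqrtr // !mulr_sumr -big_split; apply: ler_sum => i _ /=.
rewrite -subr_ge0.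
have -> : (1 + Y / X) * a i ^+ 2 + (1 + X / Y) * b i ^+ 2 - (a i + b i) ^+ 2
    = (Y * a i - X * b i) ^+ 2 / (X * Y).
  by field; rewrite !gt_eqF.
by rewrite divr_ge0 ?sqr_ge0 // mulr_ge0 // ltW.
Qed.

(** * Coordinates in an orthonormal eigenbasis *)

Section Eigenbasis.
Variables (R : realType) (m : nat) (x : 'I_m.+1 -> 'cV[R[i]]_m.+1).
Hypothesis hx : orthonormal_basis x.
Implicit Types (u v w d : 'cV[R[i]]_m.+1) (mu : R).
Local Notation normc := Normc.normc.

(** Orthonormality says that the adjoint of the matrix X of the basis is a left
inverse of X; X being square, it is also a right inverse, which is the claimed
completeness. *)
Lemma basis_expansion v : v = \sum_i dotv (x i) v *: x i.
Proof.
pose X := \matrix_(j, i) x i j 0.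
pose Xs := \matrix_(i, j) Num.conj (x i j 0).
have XsX : Xs *m X = 1%:M.
  apply/matrixP => i j; rewrite !mxE -hx dotvE.
  by apply: eq_bigr => k _; rewrite !mxE.
rewrite -[LHS]mul1mx -(mulmx1C XsX) -mulmxA.
apply/matrixP => j k; rewrite !mxE summxE; apply: eq_bigr => i _.
rewrite !mxE ord1 mulrC dotvE; congr (_ * _).
by apply: eq_bigr => l _; rewrite !mxE.
Qed.

Lemma dotv_basis u v : dotv u v = \sum_i Num.conj (dotv (x i) u) * dotv (x i) v.
Proof.
rewrite {1}(basis_expansion v) dotv_sumr; apply: eq_bigr => i _.
by rewrite dotvZr mulrC (dotv_conj (x i) u).
Qed.

Lemma parseval v : enorm v ^+ 2 = \sum_i normc (dotv (x i) v) ^+ 2.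
Proof.
apply: complexI; rewrite -dotvv dotv_basis rmorph_sum; apply: eq_bigr => i _.
exact: conjC_mul_normc.
Qed.

(** The norm of the component of v orthogonal to x 0, i.e. the sine of the angle
between v and x 0 when v is a unit vector. *)
Definition tail_norm v : R :=
  Num.sqrt (\sum_(i | i != 0) normc (dotv (x i) v) ^+ 2).

Lemma tail_norm_ge0 v : 0 <= tail_norm v.
Proof. exact: sqrtr_ge0. Qed.

Lemma tail_norm_sqr v :
  tail_norm v ^+ 2 = \sum_(i | i != 0) normc (dotv (x i) v) ^+ 2.
Proof. by rewrite sqr_sqrtr // sumr_ge0 // => i _; exact: sqr_ge0. Qed.

Lemma enorm_head_tail v :
  enorm v ^+ 2 = normc (dotv (x 0) v) ^+ 2 + tail_norm v ^+ 2.
Proof. by rewrite parseval (bigD1 0) //= tail_norm_sqr. Qed.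

Lemma tail_norm_le_enorm v : tail_norm v <= enorm v.
Proof.
rewrite -(@ler_pXn2r _ 2) ?nnegrE ?tail_norm_ge0 ?enorm_ge0 //.
by rewrite enorm_head_tail lerDr sqr_ge0.
Qed.

Lemma head_le_enorm v : normc (dotv (x 0) v) <= enorm v.
Proof.
rewrite -(@ler_pXn2r _ 2) ?nnegrE ?normc_ge0 ?enorm_ge0 //.
by rewrite enorm_head_tail lerDl sqr_ge0.
Qed.

Lemma tail_normZ (r : R) v : 0 <= r -> tail_norm (r%:C *: v) = r * tail_norm v.
Proof.
move=> r0; apply/eqP; rewrite -(@eqrXn2 _ 2) ?mulr_ge0 ?tail_norm_ge0 //.
rewrite exprMn !tail_norm_sqr mulr_sumr; apply/eqP/eq_bigr => i _.
by rewrite dotvZr Normc.normcM exprMn normc_real ger0_norm.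
Qed.

Lemma tail_normD u v : tail_norm (u + v) <= tail_norm u + tail_norm v.
Proof.
apply: le_trans (minkowski2 _ _ _); try by move=> i; exact: normc_ge0.
apply: ler_wsqrtr; apply: ler_sum => i _.
by rewrite dotvDr lerXn2r ?nnegrE ?addr_ge0 ?normc_ge0 // le_normcD.
Qed.

(** * The shifted matrix and the Rayleigh quotient *)

Variables (A : 'M[R[i]]_m.+1) (lambda : 'I_m.+1 -> R).
Hypothesis hlambda : forall i, A *m x i = (lambda i)%:C *: x i.
Local Notation shift mu := (A - mu%:C%:M).

Lemma dotv_eigen i v : dotv (x i) (A *m v) = (lambda i)%:C * dotv (x i) v.
Proof.
rewrite {1}(basis_expansion v) mulmx_sumr dotv_sumr (bigD1 i) //= big1 => [|j ji].
  by rewrite addr0 -scalemxAr hlambda !dotvZr hx eqxx mulr1 mulrC.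
by rewrite -scalemxAr hlambda !dotvZr hx eq_sym (negbTE ji) !mulr0.
Qed.

Lemma normc_dotv_shift mu i v :
  normc (dotv (x i) (shift mu *m v)) = `|lambda i - mu| * normc (dotv (x i) v).
Proof.
rewrite mulmxBl mul_scalar_mx dotvDr -scaleN1r !dotvZr dotv_eigen.
by rewrite mulN1r -mulrBl -rmorphB Normc.normcM normc_real.
Qed.

Lemma enorm_shift_sqr mu v :
  enorm (shift mu *m v) ^+ 2 =
    \sum_i (lambda i - mu) ^+ 2 * normc (dotv (x i) v) ^+ 2.
Proof.
rewrite parseval; apply: eq_bigr => i _.
by rewrite normc_dotv_shift exprMn real_normK ?num_real.
Qed.

(** Serves in both directions: for v = u it bounds the sine of the angle by the
residual, and for v = w it bounds the tail of the solution by the tail of the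
right-hand side of the linear system. *)
Lemma tail_norm_shift_ge mu g v : 0 <= g ->
  (forall i, i != 0 -> g <= `|lambda i - mu|) ->
  g * tail_norm v <= tail_norm (shift mu *m v).
Proof.
move=> g0 hg.
rewrite -(@ler_pXn2r _ 2) ?nnegrE ?mulr_ge0 ?tail_norm_ge0 //.
rewrite exprMn !tail_norm_sqr mulr_sumr; apply: ler_sum => i i0.
rewrite normc_dotv_shift exprMn ler_wpM2r ?sqr_ge0 //.
by rewrite lerXn2r ?nnegrE // hg.
Qed.

Lemma rayleigh_basis v :
  rayleigh A v = \sum_i lambda i * normc (dotv (x i) v) ^+ 2.
Proof.
rewrite /rayleigh.
suff -> : dotv v (A *m v) = (\sum_i lambda i * normc (dotv (x i) v) ^+ 2)%:C by [].
rewrite dotv_basis rmorph_sum; apply: eq_bigr => i _.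
by rewrite dotv_eigen mulrCA conjC_mul_normc -rmorphM.
Qed.

(** For a unit vector the squared norm of (A - mu) v is a monic quadratic
polynomial in mu, with its minimum at the Rayleigh quotient. *)
Lemma residual_le_shift mu v :
  enorm v = 1 -> enorm (residual A v) <= enorm (shift mu *m v).
Proof.
move=> v1; have p1 : \sum_i normc (dotv (x i) v) ^+ 2 = 1.
  by rewrite -parseval v1 expr1n.
rewrite -(@ler_pXn2r _ 2) ?nnegrE ?enorm_ge0 // !enorm_shift_sqr.
have sumE t : \sum_i (lambda i - t) ^+ 2 * normc (dotv (x i) v) ^+ 2 =
    \sum_i lambda i ^+ 2 * normc (dotv (x i) v) ^+ 2
    - 2 * t * rayleigh A v + t ^+ 2.
  have -> : t ^+ 2 = \sum_i t ^+ 2 * normc (dotv (x i) v) ^+ 2.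
    by rewrite -mulr_sumr p1 mulr1.
  rewrite rayleigh_basis !mulr_sumr -sumrB -big_split.
  by apply: eq_bigr => i _ /=; ring.
rewrite !sumE -subr_ge0; set S := \sum_i _.
have -> : S - 2 * mu * rayleigh A v + mu ^+ 2
    - (S - 2 * rayleigh A v * rayleigh A v + rayleigh A v ^+ 2)
    = (mu - rayleigh A v) ^+ 2 by ring.
exact: sqr_ge0.
Qed.

Variable s : R.
Hypothesis hs : forall i, `|lambda i - lambda 0| <= s.

Lemma spread_ge0 : 0 <= s.
Proof. exact: le_trans (normr_ge0 _) (hs 0). Qed.

(** The shift lambda 0 annihilates the head of v. *)
Lemma enorm_shift_eigen_le v :
  enorm (shift (lambda 0) *m v) <= s * tail_norm v.
Proof.
have s0 := spread_ge0.
rewrite -(@ler_pXn2r _ 2) ?nnegrE ?mulr_ge0 ?tail_norm_ge0 ?enorm_ge0 //.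
rewrite enorm_shift_sqr (bigD1 0) //= subrr expr0n mul0r add0r.
rewrite exprMn tail_norm_sqr mulr_sumr; apply: ler_sum => i _.
rewrite ler_wpM2r ?sqr_ge0 // -[leLHS]real_normK ?num_real //.
by rewrite lerXn2r ?nnegrE.
Qed.

(** The error is the mean of the differences lambda i - lambda 0, whose weights
add up to tail_norm v ^+ 2 once the vanishing term i = 0 is removed. *)
Lemma rayleigh_error v : enorm v = 1 ->
  `|lambda 0 - rayleigh A v| <= s * tail_norm v ^+ 2.
Proof.
move=> v1; have p1 : \sum_i normc (dotv (x i) v) ^+ 2 = 1.
  by rewrite -parseval v1 expr1n.
have -> : lambda 0 - rayleigh A v =
    - \sum_(i | i != 0) (lambda i - lambda 0) * normc (dotv (x i) v) ^+ 2.
  have {1}-> : lambda 0 = \sum_i lambda 0 * normc (dotv (x i) v) ^+ 2.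
    by rewrite -mulr_sumr p1 mulr1.
  rewrite rayleigh_basis -sumrB.
  rewrite (bigD1 0) //= subrr add0r -sumrN.
  by apply: eq_bigr => i _; ring.
rewrite normrN tail_norm_sqr mulr_sumr.
apply: le_trans (ler_norm_sum _ _ _) _; apply: ler_sum => i _.
by rewrite normrM [X in _ * X]ger0_norm ?sqr_ge0 // ler_wpM2r ?sqr_ge0.
Qed.

(** * One step of the iteration *)

(** The head of w is that of the right-hand side divided by
|lambda 0 - rayleigh A u|, a quantity quadratic in the angle of u, while its
tail is the tail of the right-hand side divided by at least h.  Since the
head is a lower bound of enorm w, the quotient of tail and head bounds the
sine of the new angle.  The conclusion includes that the next iterate is a unit
vector, since that rests on the same lower bound of the head of w. *)
Lemma rqi_step_bound u d w (xi c h : R) :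
  0 < c -> 0 < h -> 0 <= xi -> enorm u = 1 -> enorm d = 1 ->
  (forall i, i != 0 -> h <= `|lambda i - rayleigh A u|) ->
  shifted A u *m w = u + xi%:C *: d ->
  c <= normc (dotv (x 0) (u + xi%:C *: d)) ->
  enorm ((enorm w)^-1%:C *: w) = 1 /\
  enorm (residual A ((enorm w)^-1%:C *: w)) <=
    s ^+ 2 * (enorm (residual A u) / h) ^+ 2 * (xi + enorm (residual A u) / h)
      / (h * c).
Proof.
move=> c0 h0 xi0 u1 d1 hgap hw hc.
have s0 := spread_ge0.
(* Under hgap, r / h bounds the sine of the angle of u, and eps is the factor by
   which the solve divides the head. *)
set r := enorm (residual A u); set eps := `|lambda 0 - rayleigh A u|.
have tail_u : tail_norm u <= r / h.
  rewrite ler_pdivlMr // mulrC.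
  exact: le_trans (tail_norm_shift_ge _ (ltW h0) hgap) (tail_norm_le_enorm _).
have eps_le : eps <= s * (r / h) ^+ 2.
  apply: le_trans (rayleigh_error u1) _.
  by rewrite ler_wpM2l // lerXn2r ?nnegrE ?tail_norm_ge0 // (le_trans _ tail_u) ?tail_norm_ge0.
have head_w : c <= eps * normc (dotv (x 0) w).
  by rewrite -normc_dotv_shift [shift _ *m w]hw.
have tail_w : h * tail_norm w <= r / h + xi.
  apply: le_trans (tail_norm_shift_ge _ (ltW h0) hgap) _.
  rewrite [shift _ *m w]hw; apply: le_trans (tail_normD _ _) _.
  rewrite tail_normZ // lerD // -[leRHS]mulr1 ler_wpM2l // -d1.
  exact: tail_norm_le_enorm.
have w_gt0 : 0 < enorm w.
  rewrite lt_def enorm_ge0 andbT; apply: contraTneq (lt_le_trans c0 head_w) => w0.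
  have /le_anti -> : normc (dotv (x 0) w) <= 0 <= normc (dotv (x 0) w).
    by rewrite normc_ge0 andbT -w0 head_le_enorm.
  by rewrite mulr0 ltxx.
have wV0 : 0 <= (enorm w)^-1 by rewrite invr_ge0 ltW.
have u'1 : enorm ((enorm w)^-1%:C *: w) = 1.
  by rewrite enormZ // mulVf // gt_eqF.
split=> //; apply: le_trans (residual_le_shift (lambda 0) u'1) _.
apply: le_trans (enorm_shift_eigen_le _) _; rewrite tail_normZ //.
have wV_le : (enorm w)^-1 <= s * (r / h) ^+ 2 / c.
  rewrite -[leLHS]mul1r ler_pdivrMr // mulrAC ler_pdivlMr // mul1r.
  apply: le_trans head_w _.
  by rewrite ler_pM ?normr_ge0 ?normc_ge0 ?head_le_enorm.
have tail_w' : tail_norm w <= (xi + r / h) / h.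
  by rewrite ler_pdivlMr // mulrC (addrC xi).
apply: (@le_trans _ _ (s * ((s * (r / h) ^+ 2 / c) * ((xi + r / h) / h)))).
  by rewrite ler_wpM2l // ler_pM ?tail_norm_ge0.
by rewrite le_eqVlt; apply/orP; left; apply/eqP; field; rewrite !gt_eqF.
Qed.

End Eigenbasis.

(** * The spectral gap and the error estimate *)

Lemma lambda_spread (R : realType) (n : nat) (lambda : 'I_n.+2 -> R) i j :
  `|lambda i - lambda j| <= lambda_max lambda - lambda_min lambda.
Proof.
have lo k : lambda_min lambda <= lambda k by exact: bigmin_le.
have hi k : lambda k <= lambda_max lambda by exact: le_bigmax.
by rewrite ler_norml; have := (lo i, lo j, (hi i, hi j)); move=> [[? ?] [? ?]]; lra.
Qed.

(** Among the eigenvalues other than lambda 0 the closest one to theta is lambda 1;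
as theta is closer to lambda 0 than half the gap, the triangle inequality
leaves at least the other half between theta and lambda 1. *)
Lemma good_shift_gap (R : realType) (n : nat) (lambda : 'I_n.+2 -> R) theta :
  good_shift lambda theta ->
  0 < `|lambda 1 - lambda 0| /\
  forall i, i != 0 -> `|lambda 1 - lambda 0| / 2 <= `|lambda i - theta|.
Proof.
move=> [_ hmon hclose]; rewrite distrC; split=> [|i i0].
  by have := normr_ge0 (lambda 0 - theta); lra.
have /hmon : (1 <= (1%R : 'I_n.+2) <= i)%N.
  by rewrite /= lt0n; apply: contraNneq i0 => i0; apply/eqP/val_inj.
apply: le_trans.
have := ler_distD theta (lambda 0) (lambda 1).
by rewrite (distrC theta); lra.
Qed.

(** How the angles enter the estimates: only through their cosines, as inner
products with the reference direction. *)
Lemma decomposes_along_dotv (R : realType) (m : nat) (y v : 'cV[R[i]]_m) t :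
  enorm y = 1 -> decomposes_along y t v -> dotv y v = (cos t)%:C.
Proof.
move=> y1 [f [yf _ ->]]; rewrite dotvDr !dotvZr yf mulr0 addr0 dotvv y1.
by rewrite expr1n mulr1.
Qed.

Lemma cubic_bigO (R : realType) (K : R) :
  (fun t : R => K * t ^+ 3) =O_ (nbhs (0 : R)) (fun t : R => t ^+ 3).
Proof.
apply/eqOP; near=> k; near=> t.
rewrite normrM ler_wpM2r //; near: k; exact: nbhs_pinfty_ge.
Unshelve. all: by end_near. Qed.

Theorem theorem3 (R : realType) (n : nat) (A : 'M[R[i]]_n.+2)
    (lambda : 'I_n.+2 -> R) (x : 'I_n.+2 -> 'cV[R[i]]_n.+2)
    (hA : A \is hermsymmx)
    (hx : orthonormal_basis x)
    (hlambda : forall i, A *m x i = (lambda i)%:C *: x i)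
    (c : R) (hc : 0 < c) (xi_max : R) :
  exists2 g : R -> R,
    g =O_ (nbhs (0 : R)) (fun t : R => t ^+ 3) &
    forall (u w d : nat -> 'cV[R[i]]_n.+2) (xi : nat -> R)
      (omega : nat -> R[i]) (phi psi : nat -> R),
      inexact_rqi A u w d xi ->
      (forall k, xi k <= xi_max) ->
      (forall k, good_shift lambda (rayleigh A (u k))) ->
      rqi_angles (x 0) u d omega phi psi ->
      (forall k, c <= `|cos (phi k) + xi k * cos (psi k)|) ->
      forall k,
        enorm (residual A (u k.+1)) <=
          8 * beta lambda ^+ 2 * xi k / (c * `|lambda 1 - lambda 0|)
            * enorm (residual A (u k)) ^+ 2
          + g (enorm (residual A (u k))).
Proof.
set delta := `|lambda 1 - lambda 0|.
exists (fun t => 16 * beta lambda ^+ 2 / (c * delta ^+ 2) * t ^+ 3).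
  exact: cubic_bigO.
move=> u w d xi omega phi psi [u01 hw d1 xi0 hnext] _ hgood hangle hpos.
have x1 j : enorm (x j) = 1.
  apply/eqP; rewrite -(@eqrXn2 _ 2) ?enorm_ge0 // expr1n; apply/eqP/complexI.
  by rewrite -dotvv hx eqxx.
(* The phase omega k only rotates the component along x 0. *)
have head k : c <= Normc.normc (dotv (x 0) (u k + (xi k)%:C *: d k)).
  suff -> : Normc.normc (dotv (x 0) (u k + (xi k)%:C *: d k)) =
      `|cos (phi k) + xi k * cos (psi k)| by exact: hpos.
  have [om1 _ _ hu hd] := hangle k.
  have ox1 : enorm (omega k *: x 0) = 1.
    apply/eqP; rewrite -(@eqrXn2 _ 2) ?enorm_ge0 // expr1n; apply/eqP/complexI.
    by rewrite -dotvv dotvZl dotvZr mulrA conjC_mul_normc om1 dotvv x1 expr1n mulr1.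
  have oc1 : Normc.normc (Num.conj (omega k)) = 1.
    have := congr1 (@Normc.normc _) (conjC_mul_normc (omega k)).
    by rewrite Normc.normcM om1 mulr1 expr1n normc_real normr1.
  rewrite -[LHS]mul1r -oc1 -Normc.normcM -dotvZl dotvDr dotvZr.
  rewrite (decomposes_along_dotv ox1 hu) (decomposes_along_dotv ox1 hd).
  by rewrite -rmorphM -rmorphD normc_real.
have step k (u1 : enorm (u k) = 1) :=
  let gap := good_shift_gap (hgood k) in
  rqi_step_bound hx hlambda (fun i => lambda_spread lambda i 0) hc
    (divr_gt0 gap.1 (ltr0Sn _ 1)) (xi0 k) u1 (d1 k) gap.2 (hw k)
    (head k).
have u1 k : enorm (u k) = 1.
  by elim: k => // k /step[+ _]; rewrite hnext.
move=> k; have [_] := step k (u1 k); rewrite -hnext.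
have delta0 : 0 < delta := (good_shift_gap (hgood k)).1.
move/le_trans; apply; rewrite /beta -/delta.
by rewrite le_eqVlt; apply/orP; left; apply/eqP; field; rewrite !gt_eqF.
Qed.
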